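(* Let $A\in BL(X)$ and $\epsilon>0$. Then $$\Lambda_\epsilon(A)\subseteq\sigma_{\frac{2\epsilon}{M(A)}}(A),$$ where $M(A):=\sup\{\|A-\lambda I\|:\lambda\in\sigma(A)\}$.
   Context: $X$ is a complex Banach space and $BL(X)$ is the Banach algebra of all bounded linear operators on $X$, with identity $I$. The spectrum of $A\in BL(X)$ is $\sigma(A)=\{z\in\mathbb{C}: A-zI \text{ is not invertible}\}$. For $\epsilon>0$ the $\epsilon$-pseudospectrum of $A$ is $$\Lambda_\epsilon(A)=\sigma(A)\cup\{z\in\mathbb{C}: \|(A-zI)^{-1}\|\ge \epsilon^{-1}\}.$$ For $0<\delta<1$ the $\delta$-condition pseudospectrum of $A$ is $$\sigma_\delta(A)=\sigma(A)\cup\{z\in\mathbb{C}: \|A-zI\|\,\|(A-zI)^{-1}\|\ge \delta^{-1}\},$$ and $\sigma_1(A)=\mathbb{C}$. *)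

(* Defs.v *)
From Stdlib Require Import Reals.
From Coquelicot Require Import Coquelicot.
Open Scope R_scope.

(* [CompleteNormedModule C_AbsRing] is the type of complex Banach spaces and
   Coquelicot's [is_linear] means "linear and bounded": an element of BL(X) is
   a map [T : X -> X] together with a proof of [is_linear T]. *)

(* The operator norm, meant for bounded [T]: the supremum is then finite and
   [real] is a mere cast from [Rbar] to [R]. *)
Definition opnorm {X : NormedModule C_AbsRing} (T : X -> X) : R :=
  real (Lub_Rbar (fun r => exists x : X, norm x <= 1 /\ r = norm (T x))).

Definition shift {X : NormedModule C_AbsRing} (A : X -> X) (z : C) : X -> X :=
  fun x => minus (A x) (scal z x).

Definition is_inverse {X : NormedModule C_AbsRing} (T B : X -> X) : Prop :=
  is_linear B /\ (forall x, B (T x) = x) /\ (forall x, T (B x) = x).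

Definition invertible {X : NormedModule C_AbsRing} (T : X -> X) : Prop :=
  exists B : X -> X, is_inverse T B.

Definition spectrum {X : NormedModule C_AbsRing} (A : X -> X) (z : C) : Prop :=
  ~ invertible (shift A z).

(* Off the spectrum the inverse [B] of [A - zI] exists and is unique, so the
   existential quantifier below only names it. *)
Definition pseudospectrum {X : NormedModule C_AbsRing} (A : X -> X)
    (eps : R) (z : C) : Prop :=
  spectrum A z \/
  exists B : X -> X, is_inverse (shift A z) B /\ / eps <= opnorm B.

(* The notion is meant for 0 < delta <= 1, with value C at delta = 1.  The
   formula used for delta < 1 is kept for delta > 1, where it also gives C
   when X is nonzero, since then ||T|| ||T^-1|| >= ||I|| = 1. *)
Definition condition_pseudospectrum {X : NormedModule C_AbsRing} (A : X -> X)
    (delta : R) (z : C) : Prop :=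
  delta = 1 \/
  spectrum A z \/
  exists B : X -> X, is_inverse (shift A z) B /\
    / delta <= opnorm (shift A z) * opnorm B.

(* sup {||A - lambda I|| : lambda in the spectrum of A}; for A in BL(X) with X
   a nonzero Banach space, the spectrum is nonempty and bounded, so that the
   supremum is finite. *)
Definition M {X : NormedModule C_AbsRing} (A : X -> X) : R :=
  real (Lub_Rbar (fun r => exists lambda : C,
    spectrum A lambda /\ r = opnorm (shift A lambda))).

(* Main.v *)
(** If [z] is outside the spectrum, a Neumann series shows that every spectral
    value [lambda] satisfies [|lambda - z| <= ||A - zI||], whence
    [||A - lambda I|| <= 2 ||A - zI||] and [M A <= 2 ||A - zI||].  A resolvent
    bound [||(A - zI)^-1|| >= 1 / eps] then gives
    [||A - zI|| ||(A - zI)^-1|| >= M A / (2 eps)]. *)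
Require Import Defs.
From Stdlib Require Import Reals Lra.
From Coquelicot Require Import Coquelicot.
Open Scope R_scope.

Lemma plus_plus_opp {G : AbelianGroup} (x y : G) : plus (plus x y) (opp y) = x.
Proof. now rewrite <- plus_assoc, plus_opp_r, plus_zero_r. Qed.

Lemma minus_minus {G : AbelianGroup} (x y z : G) :
  minus (minus x y) z = minus x (plus y z).
Proof. unfold minus. now rewrite opp_plus, plus_assoc. Qed.

Lemma eq_of_minus_eq_zero {G : AbelianGroup} (x y : G) :
  minus x y = zero -> x = y.
Proof.
  intros h. apply (plus_reg_r (opp y)). now rewrite plus_opp_r.
Qed.

Lemma minus_minus_cancel {G : AbelianGroup} (x y : G) : minus x (minus x y) = y.
Proof.
  unfold minus at 1. rewrite opp_minus, plus_comm. unfold minus.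
  rewrite <- plus_assoc, plus_opp_l. apply plus_zero_r.
Qed.

(** Meant for [t = T x], [k = mu], [j = / mu]: it turns the fixed-point equation
    [x = / mu * T x - / mu * w] into [(T - mu I) x = w]. *)
Lemma minus_scal_of_eq {K : Ring} {V : ModuleSpace K} (k j : K) (t w x : V) :
  mult k j = one -> x = plus (scal j t) (opp (scal j w)) ->
  minus t (scal k x) = w.
Proof.
  intros hkj ->.
  rewrite scal_distr_l, scal_opp_r, !scal_assoc, hkj, !scal_one.
  exact (minus_minus_cancel t w).
Qed.

(** * Bounded linear maps *)

Section Linear.

Context {K : AbsRing} {U V : NormedModule K}.

Lemma linear_sum_n (l : U -> V) (a : nat -> U) (n : nat) :
  is_linear l -> sum_n (fun k => l (a k)) n = l (sum_n a n).
Proof.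
  intros hl. induction n as [|n IH].
  - now rewrite !sum_O.
  - now rewrite !sum_Sn, IH, (linear_plus _ hl).
Qed.

Lemma is_series_linear (l : U -> V) (a : nat -> U) (s : U) :
  is_linear l -> is_series a s -> is_series (fun k => l (a k)) (l s).
Proof.
  intros hl hs. unfold is_series.
  apply filterlim_ext with (fun n => l (sum_n a n)).
  - intros n. symmetry. now apply linear_sum_n.
  - apply filterlim_comp with (2 := linear_cont l s hl). exact hs.
Qed.

Lemma is_linear_minus (f g : U -> V) :
  is_linear f -> is_linear g -> is_linear (fun x => minus (f x) (g x)).
Proof.
  intros hf hg.
  apply (is_linear_comp (fun x => (f x, opp (g x)))
           (fun p => plus (fst p) (snd p))).
  - apply is_linear_prod; [exact hf|].
    exact (is_linear_comp _ _ hg is_linear_opp).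
  - apply is_linear_plus.
Qed.

Lemma linear_inj_of_bounded_below (l : U -> V) (m : R) (x y : U) :
  is_linear l -> 0 < m -> (forall u, m * norm u <= norm (l u)) ->
  l x = l y -> x = y.
Proof.
  intros hl hm hb h. specialize (hb (minus x y)).
  assert (h0 : norm (l (minus x y)) = 0).
  { rewrite (linear_minus l x y hl), h.
    exact (eq_trans (f_equal norm (minus_eq_zero (l y))) norm_zero). }
  apply eq_of_minus_eq_zero, norm_eq_zero.
  pose proof (norm_ge_0 (minus x y)). nra.
Qed.

End Linear.

(** * Neumann series and fixed points *)

Lemma is_series_iterates_fixpoint {K : AbsRing} {V : NormedModule K}
    (G : V -> V) (a : nat -> V) (s : V) :
  is_linear G -> (forall n, a (S n) = G (a n)) -> is_series a s ->
  s = plus (G s) (a O).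
Proof.
  intros hG ha hs.
  (* Both sides are sums of [a]: without its first term the series is that of [G (a n)], which sums
     to [G s] by continuity of [G]. *)
  refine (filterlim_locally_unique _ _ _ hs (is_series_decr_1 a _ _)).
  refine (eq_ind_r (is_series _) _ (plus_plus_opp (G s) (a O))).
  apply is_series_ext with (fun n => G (a n)); [now symmetry|].
  now apply is_series_linear.
Qed.

(** The fixed point is the sum of the series of iterates [G^n y], which converges by completeness
    since a geometric series of ratio [q] dominates it. *)
Lemma contraction_fixpoint {K : AbsRing} {V : CompleteNormedModule K}
    (G : V -> V) (q : R) (y : V) :
  is_linear G -> 0 <= q < 1 -> (forall x, norm (G x) <= q * norm x) ->
  exists x, x = plus (G x) y.
Proof.
  intros hG hq hn.
  set (a := fix a n := match n with O => y | S n => G (a n) end).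
  assert (ha : forall n, norm (a n) <= norm y * q ^ n).
  { induction n as [|n IH]; simpl; [lra|].
    apply Rle_trans with (1 := hn _). nra. }
  destruct (ex_series_le a (fun n => norm y * q ^ n) ha) as [s hs].
  { apply (ex_series_scal (K := R_AbsRing) (V := R_NormedModule)).
    apply ex_series_geom. rewrite Rabs_pos_eq; lra. }
  exists s.
  exact (is_series_iterates_fixpoint G a s hG (fun n => eq_refl) hs).
Qed.

(** * Complex scalars and shifts *)

Lemma norm_scal_C {X : NormedModule C_AbsRing} (k : C) (x : X) :
  norm (scal k x) = Cmod k * norm x.
Proof.
  apply Rle_antisym; [exact (norm_scal k x)|].
  destruct (Ceq_dec k 0) as [->|hk].
  { rewrite Cmod_0, Rmult_0_l. apply norm_ge_0. }
  (* The reverse inequality is submultiplicativity applied to [/ k] and [scal k x]. *)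
  assert (hx : norm x <= / Cmod k * norm (scal k x)).
  { rewrite <- Cmod_inv by exact hk.
    replace (norm x) with (norm (scal (Cinv k : C_AbsRing) (scal k x))).
    - exact (norm_scal (Cinv k : C_AbsRing) (scal k x)).
    - rewrite scal_assoc. change (mult (Cinv k : C_AbsRing) k) with (Cinv k * k)%C.
      rewrite Cinv_l by exact hk. exact (f_equal norm (scal_one x)). }
  assert (hp := Cmod_gt_0 k). apply Rmult_le_reg_l with (/ Cmod k).
  { apply Rinv_0_lt_compat. now apply hp. }
  rewrite <- Rmult_assoc, Rinv_l, Rmult_1_l; [exact hx|].
  apply Rgt_not_eq. now apply hp.
Qed.

Lemma is_linear_scal_C {X : NormedModule C_AbsRing} (k : C) :
  is_linear (fun x : X => scal k x).
Proof. exact (is_linear_scal_r (K := C_AbsRing) (V := X) k Cmult_comm). Qed.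

Lemma is_linear_shift {X : NormedModule C_AbsRing} (A : X -> X) (z : C) :
  is_linear A -> is_linear (shift A z).
Proof. intros hA. apply is_linear_minus; [exact hA|apply is_linear_scal_C]. Qed.

Lemma shift_shift {X : NormedModule C_AbsRing} (A : X -> X) (z w : C) (x : X) :
  shift (shift A z) w x = shift A (z + w)%C x.
Proof.
  assert (h : scal (z + w)%C x = plus (scal z x) (scal w x))
    by exact (scal_distr_r (z : C_Ring) w x).
  unfold shift. rewrite h. exact (minus_minus (A x) _ _).
Qed.

(* The bound [0 <= c] covers empty [E], where [real m_infty = 0]. *)
Lemma real_Lub_Rbar_le (E : R -> Prop) (c : R) :
  0 <= c -> (forall r, E r -> r <= c) -> real (Lub_Rbar E) <= c.
Proof.
  intros hc hE. destruct (Lub_Rbar_correct E) as [_ hl].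
  specialize (hl (Finite c) hE).
  destruct (Lub_Rbar E); simpl in *; tauto || lra.
Qed.

(** * The operator norm *)

Lemma opnorm_le {X : NormedModule C_AbsRing} (T : X -> X) (c : R) :
  0 <= c -> (forall x, norm x <= 1 -> norm (T x) <= c) -> opnorm T <= c.
Proof.
  intros hc hT. apply real_Lub_Rbar_le; [exact hc|].
  intros r [x [hx ->]]. now apply hT.
Qed.

Lemma norm_le_opnorm_ball {X : NormedModule C_AbsRing} (T : X -> X) (x : X) :
  is_linear T -> norm x <= 1 -> norm (T x) <= opnorm T.
Proof.
  intros hT hx. destruct (linear_norm T hT) as [c [hc hTc]]. unfold opnorm.
  set (E := fun r => _). destruct (Lub_Rbar_correct E) as [hu hl].
  assert (h1 := hu (norm (T x)) (ex_intro _ x (conj hx eq_refl))).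
  (* This bound excludes [p_infty] and [h1] excludes [m_infty], the two values that [real] would
     send to 0. *)
  assert (h2 : is_ub_Rbar E c).
  { intros r [y [hy ->]]. simpl. specialize (hTc y). nra. }
  specialize (hl _ h2).
  destruct (Lub_Rbar E); simpl in *; tauto.
Qed.

Lemma opnorm_ge_0 {X : NormedModule C_AbsRing} (T : X -> X) :
  is_linear T -> 0 <= opnorm T.
Proof.
  intros hT. apply Rle_trans with (norm (T zero)); [apply norm_ge_0|].
  apply norm_le_opnorm_ball; [exact hT|]. rewrite norm_zero. lra.
Qed.

Lemma norm_le_opnorm {X : NormedModule C_AbsRing} (T : X -> X) (x : X) :
  is_linear T -> norm (T x) <= opnorm T * norm x.
Proof.
  intros hT. destruct (Req_dec (norm x) 0) as [h0|h0].
  { rewrite (norm_eq_zero _ h0), (linear_zero T hT), norm_zero. lra. }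
  assert (hx : 0 < norm x) by (pose proof (norm_ge_0 x); lra).
  assert (hi : 0 < / norm x) by now apply Rinv_0_lt_compat.
  assert (hk : Cmod (RtoC (/ norm x)) = / norm x).
  { rewrite Cmod_R. apply Rabs_pos_eq. lra. }
  assert (h := norm_le_opnorm_ball T (scal (RtoC (/ norm x) : C_AbsRing) x) hT).
  rewrite (linear_scal T hT), !norm_scal_C, hk in h.
  rewrite Rinv_l in h by exact h0. specialize (h (Rle_refl 1)).
  apply Rmult_le_reg_l with (/ norm x); [exact hi|].
  replace (/ norm x * (opnorm T * norm x)) with (opnorm T); [exact h|].
  now field.
Qed.

(** The lower bound is used twice: it makes [S] injective, so that preimages are unique, and it
    bounds the inverse by [/ m]. *)
Lemma invertible_of_bounded_below {X : CompleteNormedModule C_AbsRing}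
    (S : X -> X) (m : R) :
  is_linear S -> 0 < m -> (forall x, m * norm x <= norm (S x)) ->
  (forall w, exists x, S x = w) -> invertible S.
Proof.
  intros hS hm hb hsurj.
  assert (hinj : forall x y, S x = S y -> x = y).
  { intros x y. now apply linear_inj_of_bounded_below with m. }
  (* Definite description selects the unique preimage of [w]; linearity then follows by applying [S]
     and using injectivity. *)
  exists (fun w => iota (fun x => S x = w)).
  assert (hB : forall w, S (iota (fun x => S x = w)) = w).
  { intros w. apply (iota_correct (fun x => S x = w)).
    destruct (hsurj w) as [x hx]. exists x. split; [exact hx|].
    intros y hy. apply hinj. now rewrite hx, hy. }
  repeat split.
  - intros x y. apply hinj. now rewrite (linear_plus S hS), !hB.
  - intros k x. apply hinj. now rewrite (linear_scal S hS), !hB.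
  - exists (/ m). split; [now apply Rinv_0_lt_compat|]. intros w.
    specialize (hb (iota (fun x => S x = w))). rewrite hB in hb.
    apply Rmult_le_reg_l with m; [exact hm|].
    rewrite <- Rmult_assoc, Rinv_r, Rmult_1_l by lra. exact hb.
  - intros x. apply hinj. apply hB.
  - exact hB.
Qed.

(** The reverse triangle inequality bounds [T - mu I] below by [Cmod mu - opnorm T]. Surjectivity
    comes from the Neumann series. *)
Lemma invertible_shift {X : CompleteNormedModule C_AbsRing}
    (T : X -> X) (mu : C) :
  is_linear T -> opnorm T < Cmod mu -> invertible (shift T mu).
Proof.
  intros hT hmu. assert (h0 := opnorm_ge_0 T hT).
  assert (hmu0 : mu <> 0%C) by (intros ->; rewrite Cmod_0 in hmu; lra).
  apply invertible_of_bounded_below with (Cmod mu - opnorm T).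
  - now apply is_linear_shift.
  - lra.
  - intros x. unfold shift.
    assert (h1 := norm_triangle_inv (T x) (scal mu x)).
    assert (h2 := norm_le_opnorm T x hT).
    rewrite norm_scal_C in h1. apply Rabs_le_between in h1. lra.
  - intros w.
    (* [(T - mu I) x = w] is rewritten as [x = / mu * T x - / mu * w], a contraction of ratio
       [opnorm T / Cmod mu < 1]. *)
    destruct (contraction_fixpoint (fun x => scal (/ mu : C)%C (T x))
      (opnorm T / Cmod mu) (opp (scal (/ mu : C)%C w))) as [x hx].
    + exact (is_linear_comp _ _ hT (is_linear_scal_C _)).
    + split.
      * apply Rdiv_le_0_compat; lra.
      * apply Rmult_lt_reg_r with (Cmod mu); [lra|].
        unfold Rdiv. rewrite Rmult_assoc, Rinv_l; lra.
    + intros x. apply Rle_trans with (1 := Req_le _ _ (norm_scal_C (/ mu) (T x))).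
      rewrite Cmod_inv by exact hmu0.
      replace (opnorm T / Cmod mu * norm x)
        with (/ Cmod mu * (opnorm T * norm x)) by (field; lra).
      apply Rmult_le_compat_l; [|now apply norm_le_opnorm].
      left. apply Rinv_0_lt_compat. lra.
    + exists x.
      exact (minus_scal_of_eq (mu : C_Ring) (/ mu)%C (T x) w x
               (Cinv_r mu hmu0) hx).
Qed.

(** Since [A - lambda I = (A - zI) - (lambda - z) I], a larger distance would make [A - lambda I]
    invertible. *)
Lemma spectrum_dist_le {X : CompleteNormedModule C_AbsRing}
    (A : X -> X) (z lambda : C) :
  is_linear A -> spectrum A lambda -> Cmod (lambda - z) <= opnorm (shift A z).
Proof.
  intros hA hl. apply Rnot_lt_le. intros h. apply hl.
  destruct (invertible_shift (shift A z) (lambda - z) (is_linear_shift A z hA) h)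
    as [B [hB [hl' hr]]].
  assert (he : forall x, shift (shift A z) (lambda - z) x = shift A lambda x).
  { intros x. rewrite shift_shift. f_equal. ring. }
  exists B. repeat split; try apply hB.
  - intros x. now rewrite <- he.
  - intros x. now rewrite <- he.
Qed.

Lemma M_le {X : CompleteNormedModule C_AbsRing} (A : X -> X) (z : C) :
  is_linear A -> M A <= 2 * opnorm (shift A z).
Proof.
  intros hA. assert (hT := is_linear_shift A z hA).
  assert (h0 := opnorm_ge_0 _ hT).
  apply real_Lub_Rbar_le; [lra|].
  intros r [lambda [hl ->]].
  assert (hd := spectrum_dist_le A z lambda hA hl).
  apply opnorm_le; [lra|]. intros x hx.
  (* The factor 2 arises here: [A - lambda I] splits into [A - zI] and [(lambda - z) I], each of
     norm at most [opnorm (shift A z)]. *)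
  replace lambda with (z + (lambda - z))%C by ring.
  rewrite <- shift_shift. unfold shift at 1.
  set (k := (lambda - z)%C) in *.
  assert (h1 := norm_triangle (shift A z x) (opp (scal k x))).
  assert (h2 := norm_le_opnorm_ball _ x hT hx).
  assert (h3 : norm (opp (scal k x)) <= Cmod k).
  { apply Rle_trans with (1 := Req_le _ _ (norm_opp (scal k x))).
    rewrite norm_scal_C. assert (h4 := Cmod_ge_0 k). nra. }
  apply Rle_trans with (1 := h1). lra.
Qed.

Theorem lemma4p3 (X : CompleteNormedModule C_AbsRing) (A : X -> X)
    (hA : is_linear A) (eps : R) (heps : 0 < eps) :
  forall z : C,
    pseudospectrum A eps z -> condition_pseudospectrum A (2 * eps / M A) z.
Proof.
  intros z [hz|[B [hB hn]]]; [now right; left|].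
  right; right. exists B. split; [exact hB|].
  assert (h0 := opnorm_ge_0 _ (is_linear_shift A z hA)).
  assert (hM := M_le A z hA).
  (* [Rinv_div] has no side condition since [/ 0 = 0], so [M A = 0] is covered. *)
  rewrite Rinv_div.
  (* The bound on [M A] gives the first inequality, the resolvent bound [hn] the second. *)
  apply Rle_trans with (opnorm (shift A z) * / eps).
  - replace (M A / (2 * eps)) with (M A / 2 * / eps) by (field; lra).
    apply Rmult_le_compat_r; [left; now apply Rinv_0_lt_compat|lra].
  - now apply Rmult_le_compat_l.
Qed.
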